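(* Let $F$ be a field of characteristic $3$ and let $B(1,2)=F1\oplus V$ be the Hurwitz superalgebra described in the context. Up to equivalence, the nontrivial gradings on the superalgebra $B(1,2)$ are: (a) the $\mathbb{Z}$-grading $B(1,2)^{0}=F1$, $B(1,2)^{1}=Fu$, $B(1,2)^{-1}=Fv$, where $\{u,v\}$ is a basis of $V$ with $(u,v)=1$; and (b) the main $\mathbb{Z}_2$-grading $B(1,2)^{\bar 0}=F1$, $B(1,2)^{\bar 1}=V$.
   Context: Gradings. A grading by a group $G$ on an algebra $\mathcal A$ is a decomposition $\mathcal A=\bigoplus_{g\in G}\mathcal A^g$ into subspaces with $\mathcal A^g\mathcal A^h\subseteq\mathcal A^{gh}$. A superalgebra is a $\mathbb{Z}_2$-graded algebra $\mathcal A=\mathcal A_{\bar0}\oplus\mathcal A_{\bar1}$; this $\mathbb{Z}_2$-grading is called the main grading. A grading on the superalgebra $\mathcal A$ is a group grading on the algebra $\mathcal A$ such that $\mathcal A^g=(\mathcal A^g\cap\mathcal A_{\bar0})\oplus(\mathcal A^g\cap\mathcal A_{\bar1})$ for all $g$. The trivial grading is $\mathcal A=\mathcal A^e$. Two gradings are equivalent if there is an isomorphism of superalgebras (an algebra isomorphism preserving the main grading) which maps each nonzero homogeneous component of the first grading onto a homogeneous component of the second. All gradings are group gradings (and the support of each grading considered generates an abelian group). The superalgebra $B(1,2)$. Let $V$ be a $2$-dimensional vector space over a field $F$ of characteristic $3$ with a nondegenerate alternating form $(\cdot,\cdot)$. Then $B(1,2)=F1\oplus V$, with $B(1,2)_{\bar0}=F1$,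 $B(1,2)_{\bar1}=V$, and multiplication $1x=x1=x$ for all $x$ and $uv=(u,v)1$ for $u,v\in V$. *)

(* Defs.v *)
From HB Require Import structures.
From mathcomp Require Import all_boot all_order all_fingroup all_algebra.

Set Implicit Arguments.
Unset Strict Implicit.
Unset Printing Implicit Defensive.

Import GRing.Theory.
Local Open Scope ring_scope.

Section Gradings.
Variable F : fieldType.

(* A = \bigoplus_g A^g over a possibly infinite group: the sum over any finite
   set of degrees is direct and, A having finite dimension, finitely many
   components already span A. *)
Definition group_grading (A : vectType F) (mul : A -> A -> A)
    (G : groupType) (Gam : G -> {vspace A}) : Prop :=
  [/\ forall s : seq G, uniq s -> directv (\sum_(g <- s) Gam g),
      exists s : seq G, (\sum_(g <- s) Gam g)%VS = fullv
    & forall (g h : G) (x y : A),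
        x \in Gam g -> y \in Gam h -> mul x y \in Gam (g * h)%g].

(* Algebras are finite-dimensional, not necessarily associative or unital. The
   group law of 'Z_2 is its addition, so 0 and 1 are the even and odd degrees. *)
Record superalgebra := Superalgebra {
  sa_space :> vectType F;
  sa_mul : {bilinear sa_space -> sa_space -> sa_space};
  sa_main : 'Z_2 -> {vspace sa_space};
  sa_mainP : group_grading sa_mul sa_main
}.

Inductive generated (G : groupType) (S : G -> Prop) : G -> Prop :=
| generated_mem g of S g : generated S g
| generated1 : generated S 1%g
| generatedM g h of generated S g & generated S h : generated S (g * h)%g
| generatedV g of generated S g : generated S g^-1%g.

Section OnSuperalgebra.
Variables (A : superalgebra) (G : groupType) (Gam : G -> {vspace A}).

Definition grading_support (g : G) : Prop := Gam g != 0%VS.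

Definition abelian_support : Prop :=
  forall g h : G,
    generated grading_support g -> generated grading_support h -> commute g h.

Definition super_grading : Prop :=
  [/\ group_grading (sa_mul A) Gam,
      forall g : G,
        directv ((Gam g :&: sa_main A 0%R) + (Gam g :&: sa_main A 1%R)) /\
        Gam g = ((Gam g :&: sa_main A 0%R) + (Gam g :&: sa_main A 1%R))%VS
    & abelian_support].

Definition trivial_grading : Prop := Gam 1%g = fullv.

End OnSuperalgebra.

Definition superalgebra_iso (A B : superalgebra) (f : 'Hom(A, B)) : Prop :=
  [/\ bijective f,
      forall x y : A, f (sa_mul A x y) = sa_mul B (f x) (f y)
    & forall i : 'Z_2, (f @: sa_main A i)%VS = sa_main B i].

Definition equivalent_gradings (A B : superalgebra) (G H : groupType)
    (Gam : G -> {vspace A}) (Del : H -> {vspace B}) : Prop :=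
  exists f : 'Hom(A, B), superalgebra_iso f /\
    forall g : G, Gam g != 0%VS -> exists h : H, (f @: Gam g)%VS = Del h.

End Gradings.

Arguments trivial_grading {F A G} Gam.
Arguments super_grading {F A G} Gam.

Section B12.
Variables (F : fieldType) (V : vectType F).

Definition alternating_form (b : {biscalar V}) : Prop :=
  forall u : V, b u u = 0.

(* Left radical only: for an alternating form both radicals agree. *)
Definition nondegenerate_form (b : {biscalar V}) : Prop :=
  forall u : V, (forall v : V, b u v = 0) -> u = 0.

Variable b : {biscalar V}.

(* The pair (a, u) stands for a1 + u. *)
Definition B12_space : vectType F := (F^o * V)%type.

Definition B12_mul (x y : B12_space) : B12_space :=
  (x.1 * y.1 + b x.2 y.2, x.1 *: y.2 + y.1 *: x.2).

Fact B12_mul_bilinear : bilinear_for *:%R *:%R B12_mul.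
Proof.
split=> [y|x] a u v; congr pair; rewrite /= ?linearPl ?linearPr /=.
- by rewrite mulrDl -scalerAl scalerDr /= addrACA.
- rewrite scalerDl scalerDr [X in _ = X + _]scalerDr !scalerA.
  by rewrite [y.1 * a]mulrC addrACA.
- by rewrite mulrDr [_ *: (_ + _)]mulrDr -scalerAr addrACA.
- by rewrite scalerDl !scalerDr !scalerA [x.1 * a]mulrC addrACA.
Qed.

HB.instance Definition _ :=
  bilinear_isBilinear.Build F B12_space B12_space B12_space *:%R *:%R
    B12_mul B12_mul_bilinear.

Definition B12_scalar (a : F) : B12_space := (a, 0).
Definition B12_vector (u : V) : B12_space := (0, u).

Definition B12_even : {vspace B12_space} := <[B12_scalar 1]>%VS.
Definition B12_odd : {vspace B12_space} := limg (linfun B12_vector).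

Definition B12_main (i : 'Z_2) : {vspace B12_space} :=
  if i == 0 then B12_even else B12_odd.

Fact B12_vector_linear : linear B12_vector.
Proof. by move=> a u v; congr pair; rewrite /= scaler0 addr0. Qed.

HB.instance Definition _ :=
  GRing.isLinear.Build F V B12_space *:%R B12_vector B12_vector_linear.

Fact mem_B12_even (x : B12_space) : (x \in B12_even) = (x.2 == 0).
Proof.
apply/vlineP/eqP=> [[k ->]|x0]; first by rewrite /= scaler0.
exists x.1; rewrite [LHS]surjective_pairing x0.
by congr pair; rewrite /= ?scaler0 // [RHS]mulr1.
Qed.

Fact mem_B12_odd (x : B12_space) : (x \in B12_odd) = (x.1 == 0).
Proof.
apply/memv_imgP/eqP=> [[u _ ->]|x0]; first by rewrite lfunE.
by exists x.2; rewrite ?memvf // lfunE /= [LHS]surjective_pairing x0.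
Qed.

Fact B12_main_direct : directv (B12_even + B12_odd).
Proof.
apply/directv_addP/eqP; rewrite -subv0; apply/subvP=> x.
rewrite memv_cap mem_B12_even mem_B12_odd memv0 => /andP[/eqP x2 /eqP x1].
by rewrite [x]surjective_pairing x1 x2.
Qed.

Fact B12_main_full : (B12_even + B12_odd)%VS = fullv.
Proof.
apply/eqP; rewrite eqEsubv subvf; apply/subvP=> x _.
have -> : x = (B12_scalar x.1 : B12_space) + B12_vector x.2.
  by rewrite [LHS]surjective_pairing; congr pair; rewrite /= ?addr0 ?add0r.
by apply: memv_add; rewrite ?mem_B12_even ?mem_B12_odd /=.
Qed.

Fact B12_mainP : group_grading B12_mul B12_main.
Proof.
have Z2P (i : 'Z_2) : i = 0 \/ i = 1.
  by case: i => [[|[|//]] ?]; [left|right]; apply: val_inj.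
split.
- move=> s us; rewrite directvE /=.
  have dir : directv (\sum_(i : 'Z_2) B12_main i).
    rewrite directvE /= !big_ord_recl !big_ord0 /= addv0 addn0.
    by have := B12_main_direct; rewrite directvE.
  rewrite (big_uniq _ us) [X in _ == X](big_uniq _ us) /=.
  suff : directv (\sum_(i in s) B12_main i) by rewrite directvE.
  apply/directv_sum_independent => us' us'P s0 i is_.
  have /directv_sum_independent := dir.
  move/(_ (fun j => if j \in s then us' j else 0)) => /=.
  move/(_ _ _ i isT); rewrite is_; apply.
    by move=> j _; case: ifP => [/us'P //|_]; rewrite mem0v.
  by rewrite -big_mkcond.
- exists [:: 0; 1 : 'Z_2]; rewrite !big_cons big_nil addv0.
  exact: B12_main_full.
- move=> g h x y.
  by case: (Z2P g) => ->; case: (Z2P h) => ->;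
     rewrite /B12_main /= ?mem_B12_even ?mem_B12_odd /= => /eqP-> /eqP->;
     rewrite ?mul0r ?mulr0 ?scale0r ?scaler0 ?linear0l ?linear0r ?addr0.
Qed.

Definition B12 : superalgebra F := Superalgebra (sa_mul := B12_mul) B12_mainP.

Definition B12_Zgrading (u v : V) (n : Algebra.to_multiplicative int) : {vspace B12} :=
  if n == 0 :> int then <[B12_scalar 1]>%VS
  else if n == 1 :> int then <[B12_vector u]>%VS
  else if n == -1 :> int then <[B12_vector v]>%VS
  else 0%VS.

End B12.

(* Main.v *)
(* The unit 1 spans the even part and is idempotent, so it has degree e. Since
   the odd part V is a graded subspace, nondegeneracy provides homogeneous
   x, y in V with (x, y) = 1; then xy = 1 forces deg x * deg y = e, and x, y
   form a basis of V. If the two degrees coincide, V is a single component,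
   of degree different from e as the grading is nontrivial: this is the main
   grading. Otherwise F1, Fx and Fy are the components, and the symplectic map
   x |-> u, y |-> v carries them to those of the Z-grading. *)
Require Import Defs.
From HB Require Import structures.
From mathcomp Require Import all_boot all_order all_fingroup all_algebra.

Set Implicit Arguments.
Unset Strict Implicit.
Unset Printing Implicit Defensive.

Import GRing.Theory.
Local Open Scope ring_scope.

(** * Dimension counts for families of subspaces *)

Section Families.
Variables (F : fieldType) (A : vectType F) (I : eqType).
Implicit Types (Gam W : I -> {vspace A}) (s t : seq I).

Lemma dim_sum_le Gam s (P : pred I) :
  (\dim (\sum_(i <- s | P i) Gam i) <= \sum_(i <- s | P i) \dim (Gam i))%N.
Proof.
elim/big_rec2: _ => [|i U n _ le]; first by rewrite dimv0.
by apply: leq_trans (dimv_add_leqif _ _) _; rewrite leq_add2l.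
Qed.

Lemma sub_family_sum Gam s (U : {vspace A}) :
  (forall i, i \in s -> (Gam i <= U)%VS) -> (\sum_(i <- s) Gam i <= U)%VS.
Proof.
elim: s => [|i s IHs] GU; first by rewrite big_nil sub0v.
rewrite big_cons subv_add GU ?mem_head // IHs // => j js.
by apply: GU; rewrite inE js orbT.
Qed.

Lemma direct_family_cap Gam i j :
  (forall s, uniq s -> directv (\sum_(k <- s) Gam k)) -> i != j ->
  (Gam i :&: Gam j)%VS = 0%VS.
Proof.
move=> dir ij; apply/directv_addP; rewrite directvE /=.
have /dir : uniq [:: i; j] by rewrite /= inE ij.
by rewrite directvE /= !big_cons !big_nil addv0 addn0.
Qed.

(** If the dimensions over [t] add up to no more than that of the space they span, subadditivity
    leaves no slack, so every subfamily is direct as well; indices outside [t] contribute zero. *)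
Lemma directv_full_family Gam s t :
  uniq s -> uniq t -> (forall i, i \notin t -> Gam i = 0%VS) ->
  (\sum_(i <- t) Gam i)%VS = fullv ->
  (\sum_(i <- t) \dim (Gam i) <= \dim {:A})%N ->
  directv (\sum_(i <- s) Gam i).
Proof.
move=> us ut G0 full dimt.
rewrite directvE /=.
have eq_filter : perm_eq [seq i <- s | i \in t] [seq i <- t | i \in s].
  apply: uniq_perm; rewrite ?filter_uniq // => i.
  by rewrite !mem_filter andbC.
have -> : (\sum_(i <- s) Gam i = \sum_(i <- t | i \in s) Gam i)%VS.
  rewrite -[RHS]big_filter -(perm_big _ eq_filter) big_filter /=.
  rewrite (bigID (mem t)) /= [X in (_ + X)%VS]big1 ?addv0 //.
have -> : (\sum_(i <- s) \dim (Gam i) = \sum_(i <- t | i \in s) \dim (Gam i))%N.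
  rewrite -[RHS]big_filter -(perm_big _ eq_filter) big_filter /=.
  rewrite (bigID (mem t)) /= [X in (_ + X)%N]big1 ?addn0 // => i it.
  by rewrite G0 ?dimv0.
rewrite eqn_leq dim_sum_le /=.
(* Both sides are split by membership in [s]; the part outside [s] is bounded by subadditivity and
   cancels. *)
move: dimt; rewrite -full (bigID (mem s)) /= => dimt.
rewrite -(leq_add2r (\sum_(i <- t | i \notin s) \dim (Gam i))).
apply: leq_trans dimt _; rewrite (bigID (mem s)) /=.
apply: leq_trans (dimv_add_leqif _ _) _; rewrite leq_add2l.
exact: dim_sum_le.
Qed.

(** Were some [W k] smaller than [Gam k], the dimensions of the direct family would exceed that of
    the space spanned by [W]. This identifies all components of a grading once a spanning family has
    been found inside them. *)
Lemma direct_family_eq Gam W s :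
  (forall t, uniq t -> directv (\sum_(i <- t) Gam i)) ->
  uniq s -> (forall i, (W i <= Gam i)%VS) ->
  (\sum_(i <- s) W i)%VS = fullv -> forall i, Gam i = W i.
Proof.
move=> dir us WG full k; apply/esym/eqP; rewrite eqEdim WG /=.
(* Whether or not [k] occurs in [s], the list [k :: t] is duplicate-free and its [W] still span. *)
pose t := rem k s.
have ukt : uniq (k :: t) by rewrite /= mem_rem_uniqF ?rem_uniq.
have fullt : (W k + \sum_(i <- t) W i)%VS = fullv.
  apply/eqP; rewrite eqEsubv subvf /= -full.
  have [ks|nks] := boolP (k \in s); first by rewrite (big_rem k ks) /= subvv.
  by rewrite /t rem_id // addvSr.
have:= dir _ ukt; rewrite directvE /= !big_cons => /eqP dimG.
rewrite -(leq_add2r (\sum_(i <- t) \dim (Gam i))) -dimG.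
apply: leq_trans (dimvS (subvf _)) _; rewrite -fullt.
apply: leq_trans (dimv_add_leqif _ _) _; rewrite leq_add2l.
apply: leq_trans (dim_sum_le _ _ _) _.
by apply: leq_sum => i _; apply: dimvS.
Qed.
End Families.

(** * Homogeneous elements of a given parity *)

Section Homogeneous.
Variables (F : fieldType) (A : superalgebra F).

Lemma homogeneous_degree_inj (G : groupType) (Gam : G -> {vspace A}) x g h :
  group_grading (sa_mul A) Gam -> x != 0 ->
  x \in Gam g -> x \in Gam h -> g = h.
Proof.
case=> dir _ _ x0 xg xh; apply/eqP/negPn/negP => gh.
have : x \in (Gam g :&: Gam h)%VS by rewrite memv_cap xg.
by rewrite (direct_family_cap dir gh) memv0 (negPf x0).
Qed.

(** Each [Gam g] splits by parity, so the two sums of intersections together span [A]; each lies in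
    its main component, hence fills it by [direct_family_eq]. *)
Lemma main_eq_sum_cap (G : groupType) (Gam : G -> {vspace A}) (s : seq G) i :
  super_grading Gam -> (\sum_(g <- s) Gam g)%VS = fullv ->
  sa_main A i = (\sum_(g <- s) (Gam g :&: sa_main A i))%VS.
Proof.
move=> [_ capE _] full; have [dir _ _] := sa_mainP A.
pose W i := (\sum_(g <- s) (Gam g :&: sa_main A i))%VS.
apply: (direct_family_eq (W := W) (s := [:: 0; 1 : 'Z_2]) dir) => // [j|].
  by apply: sub_family_sum => g _; apply: capvSr.
rewrite !big_cons big_nil addv0 /W -big_split /= -full.
by apply: eq_bigr => g _; have [_ <-] := capE g.
Qed.

(** The homogeneous elements of parity [i] span that main component, so a functional killing all of
    them would vanish on it. *)
Lemma homogeneous_notin_lker (G : groupType) (Gam : G -> {vspace A})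
    (phi : 'Hom(A, F^o)) i x :
  super_grading Gam -> x \in sa_main A i -> phi x != 0 ->
  exists g z, [/\ z \in Gam g, z \in sa_main A i & phi z != 0].
Proof.
move=> Gr xi phix; have [[_ [s full] _] _ _] := Gr.
have [|no] := boolP (has (fun g => ~~ (Gam g :&: sa_main A i <= lker phi)%VS) s).
  case/hasP=> g _ /subvPn[z]; rewrite memv_cap memv_ker => /andP[zg zi] phiz.
  by exists g, z.
case/negP: phix; rewrite -memv_ker; apply: subvP xi.
rewrite (main_eq_sum_cap i Gr full); apply: sub_family_sum => g gs.
by apply: contraNT no => nle; apply/hasP; exists g.
Qed.

Lemma main_capv0 : (sa_main A 0%R :&: sa_main A 1%R)%VS = 0%VS.
Proof.
by have [dir _ _] := sa_mainP A; apply: direct_family_cap dir _.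
Qed.

Lemma sub_main_super (U : {vspace A}) (i : 'Z_2) :
  (U <= sa_main A i)%VS ->
  directv ((U :&: sa_main A 0%R) + (U :&: sa_main A 1%R)) /\
  U = ((U :&: sa_main A 0%R) + (U :&: sa_main A 1%R))%VS.
Proof.
move=> Ui; split.
  apply/directv_addP/eqP; rewrite -subv0 -main_capv0.
  by apply: capvS; apply: capvSr.
apply/eqP; rewrite eqEsubv subv_add !capvSl !andbT.
have [j0|j1] : i = 0 \/ i = 1.
  by case: i {Ui} => [[|[|//]] ?]; [left|right]; apply: val_inj.
- by apply: subv_trans (addvSl _ _); rewrite subv_cap subvv -j0.
- by apply: subv_trans (addvSr _ _); rewrite subv_cap subvv -j1.
Qed.

End Homogeneous.

(** * Hyperbolic pairs in a symplectic plane *)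

Section SymplecticPlane.
Variables (F : fieldType) (V : vectType F) (dimV : \dim {:V} = 2%N).
Variables (b : {biscalar V}) (b_alt : alternating_form b).

Lemma alternating_skew x y : b x y = - b y x.
Proof.
apply/eqP; rewrite -addr_eq0; apply/eqP.
have := b_alt (x + y).
by rewrite linearDl !linearDr !b_alt add0r addr0.
Qed.

Lemma hyperbolic_basis x y : b x y = 1 -> basis_of {:V} [:: x; y].
Proof.
move=> bxy; rewrite basisEfree subvf dimV /= andbT.
rewrite free_cons seq1_free span_seq1; apply/andP; split.
  apply/vlineP=> -[k xE]; move: bxy; rewrite xE linearZl /= b_alt mulr0.
  by move/eqP; rewrite eq_sym oner_eq0.
apply/eqP=> y0; move: bxy; rewrite y0 linear0r.
by move/eqP; rewrite eq_sym oner_eq0.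
Qed.

(** Pairing a linear combination of [x] and [y] with [y] on the right and with [x] on the left reads
    off its two coefficients. *)
Lemma hyperbolic_expand x y w : b x y = 1 -> w = b w y *: x + b x w *: y.
Proof.
move=> bxy; have /span_basis span_xy := hyperbolic_basis bxy.
have : w \in <<[:: x; y]>>%VS by rewrite span_xy memvf.
rewrite span_cons span_seq1 => /memv_addP[_ /vlineP[k ->] [_ /vlineP[l ->] ->]].
rewrite linearDl linearDr !linearZl !linearZr /= !b_alt bxy.
by rewrite !mulr0 !mulr1 addr0 add0r.
Qed.

(** Inclusion in the kernel of [b x] is decidable, so the witness is obtained constructively. *)
Lemma nondegenerate_pair x :
  nondegenerate_form b -> x != 0 -> exists y, b x y != 0.
Proof.
move=> nd x0; pose phi : 'Hom(V, F^o) := linfun (b x : V -> F^o).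
have [|/subvPn[y _]] := boolP (fullv <= lker phi)%VS.
  move=> /subvP sub; case/eqP: x0; apply: nd => v.
  by have := sub v (memvf v); rewrite memv_ker lfunE => /eqP.
by rewrite memv_ker lfunE /= => ?; exists y.
Qed.
End SymplecticPlane.

(** * Both listed gradings are nontrivial gradings of the superalgebra *)

Section B12Gradings.
Variables (F : fieldType) (V : vectType F) (dimV : \dim {:V} = 2%N).
Variables (b : {biscalar V}) (b_alt : alternating_form b).

Lemma dim_B12 : \dim {:B12 b} = 3%N.
Proof. by move: dimV; rewrite !dimvf => dim2; rewrite [LHS]/= /dim /= dim2. Qed.

Lemma dim_B12_even : \dim (sa_main (B12 b) 0) = 1%N.
Proof.
by rewrite /= /B12_main eqxx dim_vline xpair_eqE oner_eq0.
Qed.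

Lemma mem_B12_main (i : 'Z_2) (z : B12 b) :
  z \in sa_main (B12 b) i = if i == 0 then z.2 == 0 else z.1 == 0.
Proof.
by rewrite /= /B12_main; case: ifP => _; rewrite ?mem_B12_even ?mem_B12_odd.
Qed.

Lemma B12_hyperbolic_full x y : b x y = 1 ->
  (<[B12_scalar V 1 : B12 b]> + (<[B12_vector x]> + <[B12_vector y]>))%VS = fullv.
Proof.
move=> bxy; apply/eqP; rewrite eqEsubv subvf; apply/subvP=> z _.
have -> : z = z.1 *: (B12_scalar V 1 : B12 b)
            + (b z.2 y *: (B12_vector x : B12 b) + b x z.2 *: B12_vector y).
  rewrite [LHS]surjective_pairing; congr pair; rewrite /=.
    by rewrite !scaler0 !addr0 [RHS]mulr1.
  by rewrite scaler0 add0r -hyperbolic_expand.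
by rewrite !memv_add ?memvZ ?memv_line.
Qed.

Lemma B12_main_super : super_grading (sa_main (B12 b)).
Proof.
split=> [|g|g h _ _]; first exact: sa_mainP.
  exact: (sub_main_super (i := g)).
exact: addrC.
Qed.

Lemma B12_main_nontrivial : ~ trivial_grading (sa_main (B12 b)).
Proof.
rewrite /trivial_grading => eq_full.
by have := dim_B12; rewrite -eq_full dim_B12_even.
Qed.

(** Parity 1 is assigned to every nonzero degree; beyond [1] and [-1] this is harmless, the
    component being zero. *)
Lemma B12_Zgrading_sub_main u v n :
  (B12_Zgrading b u v n <= sa_main (B12 b) (n != 0 :> int)%:R)%VS.
Proof.
rewrite /B12_Zgrading; case: ifP => [_|_] /=; first by rewrite subvv.
by case: ifP => _; [|case: ifP => _]; rewrite ?sub0v // -memvE mem_B12_odd /=.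
Qed.

Lemma B12_vectorZ a (u : V) :
  B12_vector (a *: u) = a *: (B12_vector u : B12_space V).
Proof. by congr pair; rewrite /= scaler0. Qed.

Lemma mem_B12_Zgrading u v (n : int) (z : B12 b) : z \in B12_Zgrading b u v n ->
  [\/ z = 0, n = 0 /\ exists a, z = B12_scalar V a,
      n = 1 /\ exists a, z = B12_vector (a *: u)
    | n = -1 /\ exists a, z = B12_vector (a *: v)].
Proof.
rewrite /B12_Zgrading; case: eqP => [n0|_].
  rewrite mem_B12_even => /eqP z0; constructor 2; split=> //.
  by exists z.1; rewrite [LHS]surjective_pairing z0.
case: eqP => [n1|_].
  case/vlineP=> a ->; constructor 3; split=> //; exists a.
  by rewrite B12_vectorZ.
case: eqP => [n1|_]; last by rewrite memv0 => /eqP; constructor 1.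
case/vlineP=> a ->; constructor 4; split=> //; exists a.
by rewrite B12_vectorZ.
Qed.

Lemma B12_vector_line (u : V) (a : F) :
  ((0, a *: u) : B12_space V) \in <[B12_vector u]>%VS.
Proof. by rewrite [(0, _)]B12_vectorZ memvZ ?memv_line. Qed.

Lemma B12_Zgrading_group u v :
  b u v = 1 -> group_grading (sa_mul (B12 b)) (B12_Zgrading b u v).
Proof.
move=> buv.
(* Without the cast through [int], [1] would be the group unit, i.e. degree 0. *)
pose degs : seq (Algebra.to_multiplicative int) := ([:: 0; 1; -1] : seq int).
have full : (\sum_(n <- degs) B12_Zgrading b u v n)%VS = fullv.
  by rewrite !big_cons big_nil addv0 -(B12_hyperbolic_full buv).
split=> [s us||].
- apply: directv_full_family us _ _ full _ => // [n|].
    rewrite !inE !negb_or => /and3P[/negPf n0 /negPf n1 /negPf n2].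
    by rewrite /B12_Zgrading n0 n1 n2.
  (* Each of the three lines has dimension at most 1, and the algebra has dimension 3. *)
  rewrite !big_cons big_nil dim_B12 /B12_Zgrading /= !dim_vline.
  by do 3!case: (_ != _).
- by exists degs.
move=> g h x y; have bvu : b v u = -1 by rewrite alternating_skew // buv.
move=> /mem_B12_Zgrading[->|[g0 [a ->]]|[g0 [a ->]]|[g0 [a ->]]].
  by rewrite linear0l mem0v.
all: move=> /mem_B12_Zgrading[->|[h0 [c ->]]|[h0 [c ->]]|[h0 [c ->]]].
all: try by rewrite linear0r mem0v.
(* In degrees [2] and [-2] the component is zero, as is the product, the form being alternating; the
   products of [u] and [v] in either order are scalars of degree 0. *)
all: rewrite /= /B12_mul /= ?linearZl ?linearZr /= ?linear0l ?linear0r.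
all: rewrite ?scaler0 ?scale0r ?mulr0 ?mul0r ?addr0 ?add0r ?b_alt ?buv ?bvu.
all: rewrite ?mulr0 ?scalerA; subst g h.
all: rewrite /B12_Zgrading /= ?mem0v //.
all: try by rewrite ?mem_B12_even ?B12_vector_line.
Qed.

Lemma B12_Zgrading_super u v :
  b u v = 1 -> super_grading (B12_Zgrading b u v).
Proof.
move=> buv; split=> [|n|m n _ _]; first exact: B12_Zgrading_group.
  exact: sub_main_super (B12_Zgrading_sub_main u v n).
exact: Algebra.commuteT.
Qed.

Lemma B12_Zgrading_nontrivial u v : ~ trivial_grading (B12_Zgrading b u v).
Proof.
rewrite /trivial_grading => eq_full.
by have := dim_B12; rewrite -eq_full dim_B12_even.
Qed.

End B12Gradings.

(** * Automorphisms induced by symplectic maps of the plane *)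

Section HyperbolicMap.
Variables (F : fieldType) (V : vectType F) (b : {biscalar V}).

(** For hyperbolic [x, y] the coefficients are the coordinates of [z.2], so this fixes the unit and
    sends [x] to [u] and [y] to [v]. *)
Definition hyperbolic_map (x y u v : V) (z : B12 b) : B12 b :=
  (z.1, b z.2 y *: u + b x z.2 *: v).

Fact hyperbolic_map_linear x y u v : linear (hyperbolic_map x y u v).
Proof.
move=> a z t; congr pair; rewrite /= linearPl linearPr /=.
by rewrite !scalerDl scalerDr !scalerA addrACA.
Qed.

HB.instance Definition _ x y u v :=
  GRing.isLinear.Build F (B12 b) (B12 b) *:%R (hyperbolic_map x y u v)
    (hyperbolic_map_linear x y u v).

Hypotheses (dimV : \dim {:V} = 2%N) (b_alt : alternating_form b).

Lemma hyperbolic_mapK x y u v : b x y = 1 -> b u v = 1 ->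
  cancel (hyperbolic_map x y u v) (hyperbolic_map u v x y).
Proof.
move=> bxy buv z; rewrite [RHS]surjective_pairing; congr pair => /=.
rewrite [RHS](hyperbolic_expand dimV b_alt _ bxy).
rewrite linearDl linearDr !linearZl !linearZr /= !b_alt buv.
by rewrite !mulr0 !mulr1 addr0 add0r.
Qed.

Lemma hyperbolic_map_iso x y u v : b x y = 1 -> b u v = 1 ->
  superalgebra_iso (linfun (hyperbolic_map x y u v)).
Proof.
move=> bxy buv; have fK := hyperbolic_mapK bxy buv.
have gK := hyperbolic_mapK buv bxy.
split=> [|z t|i].
- by exists (hyperbolic_map u v x y) => z; rewrite lfunE; [apply: fK|apply: gK].
(* In any hyperbolic basis the form is the determinant of the coordinates, so it takes the same
   value before and after the change of basis. *)
- have form p q r s c d : b c d = 1 ->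
      b (p *: c + q *: d) (r *: c + s *: d) = p * s - q * r.
    move=> bcd; have bdc : b d c = -1 by rewrite alternating_skew // bcd.
    rewrite linearDl !linearDr !linearZl !linearZr /= !b_alt bcd bdc.
    by rewrite !mulr0 mulr1 mulrN1 addr0 add0r mulrN.
  rewrite !lfunE; congr pair => /=.
    rewrite form // [in LHS](hyperbolic_expand dimV b_alt z.2 bxy).
    by rewrite [X in b _ X](hyperbolic_expand dimV b_alt t.2 bxy) form.
  rewrite linearDl linearDr !linearZl !linearZr /= !scalerDr !scalerDl !scalerA.
  by rewrite addrACA.
- apply/eqP; rewrite eqEsubv; apply/andP; split; apply/subvP=> z.
    case/memv_imgP=> t ti ->; move: ti; rewrite lfunE !mem_B12_main /=.
    by case: ifP => // _ /eqP->; rewrite linear0l linear0r !scale0r addr0.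
  move=> zi; apply/memv_imgP; exists (hyperbolic_map u v x y z).
    move: zi; rewrite !mem_B12_main; case: ifP => //= _ /eqP->.
    by rewrite linear0l linear0r !scale0r addr0.
  by rewrite lfunE /= gK.
Qed.

End HyperbolicMap.

(** * Inequivalence of the two gradings and classification *)

Section Classification.
Variables (F : fieldType) (V : vectType F) (dimV : \dim {:V} = 2%N).
Variables (b : {biscalar V}) (b_alt : alternating_form b).

(** An equivalence would carry the odd line spanned by [u] onto a main component; that component
    would have to be the odd part, which is a plane. *)
Lemma B12_Zgrading_not_main u v :
  b u v = 1 -> ~ equivalent_gradings (B12_Zgrading b u v) (sa_main (B12 b)).
Proof.
move=> buv [f [[f_bij _ f_main] f_comp]].
have u0 : (B12_vector u : B12 b) != 0.
  rewrite xpair_eqE negb_and; apply/orP; right; apply/eqP=> uE.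
  by move: buv; rewrite uE linear0l => /eqP; rewrite eq_sym oner_eq0.
have line1 : B12_Zgrading b u v (1 : int) = <[B12_vector u]>%VS by [].
have [|i] := f_comp (1 : int); first by rewrite line1 -dimv_eq0 dim_vline u0.
rewrite line1 limg_line => fu.
have fu0 : f (B12_vector u) != 0.
  by apply: contra_neq u0 => fu0; apply: (bij_inj f_bij); rewrite fu0 linear0.
have odd_fu : f (B12_vector u) \in sa_main (B12 b) 1.
  by rewrite -f_main memv_img // mem_B12_main /=.
have i1 : (1 : 'Z_2) = i.
  apply: (homogeneous_degree_inj (sa_mainP (B12 b)) fu0) => //.
  by rewrite -fu memv_line.
(* The odd part is a complement of the even line in dimension 3. *)
have dim_odd : \dim (sa_main (B12 b) 1) = 2%N.
  apply/eqP; rewrite -(eqn_add2l 1) -[X in (X + _)%N](dim_B12_even b).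
  rewrite -dimv_disjoint_sum ?main_capv0 // [X in \dim X](_ : _ = fullv).
    by rewrite dim_B12.
  exact: B12_main_full.
by have := dim_vline (f (B12_vector u)); rewrite fu fu0 -i1 dim_odd.
Qed.

Section Grading.
Variables (G : groupType) (Gam : G -> {vspace B12 b}).
Hypothesis Gr : super_grading Gam.

(** The functional taking the coefficient of the unit yields a homogeneous even element that is a
    nonzero scalar. Rescaled, it is the unit, whose idempotence forces [g * g = g]. *)
Lemma B12_one_degree : (B12_scalar V 1 : B12 b) \in Gam 1%g.
Proof.
pose e : B12 b := B12_scalar V 1.
pose phi : 'Hom(B12 b, F^o) := linfun fst.
have [||g [z [zg]]] := homogeneous_notin_lker (phi := phi) (i := 0) (x := e) Gr.
- by rewrite mem_B12_main /=.
- by rewrite lfunE /= oner_eq0.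
rewrite mem_B12_main lfunE /= => /eqP z2 z1.
have eg : e \in Gam g.
  have -> : e = z.1^-1 *: z.
    rewrite [z in RHS]surjective_pairing z2.
    by congr pair; rewrite /= ?scaler0 // [RHS]mulVf.
  exact: memvZ.
have [Ggr _ _] := Gr; have [_ _ mulG] := Ggr.
have e0 : e != 0 by rewrite xpair_eqE oner_eq0.
have egg : e \in Gam (g * g)%g.
  suff -> : e = sa_mul (B12 b) e e by apply: mulG.
  by congr pair; rewrite /= ?linear0l ?scaler0 addr0 ?mulr1.
have gg := homogeneous_degree_inj Ggr e0 eg egg.
by have -> : 1%g = g by apply: (@mulgI _ g); rewrite mulg1.
Qed.

(** The functional that pairs the odd part of an element with [w] is nonzero at [y0], hence at some
    homogeneous odd element. *)
Lemma B12_odd_form_neq0 w y0 : b w y0 != 0 ->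
  exists g y, (B12_vector y : B12 b) \in Gam g /\ b w y != 0.
Proof.
move=> by0; pose phi : 'Hom(B12 b, F^o) := linfun (b w \o snd : B12 b -> F^o).
have [||g [z [zg]]] :=
  homogeneous_notin_lker (phi := phi) (i := 1) (x := B12_vector y0) Gr.
- by rewrite mem_B12_main /=.
- by rewrite lfunE.
rewrite mem_B12_main lfunE /= => /eqP z1 bz; exists g, z.2; split=> //.
by rewrite /B12_vector -z1 -surjective_pairing.
Qed.

Lemma B12_hyperbolic_degrees (u v : V) :
  nondegenerate_form b -> b u v = 1 ->
  exists g h x y, [/\ (B12_vector x : B12 b) \in Gam g,
    (B12_vector y : B12 b) \in Gam h, b x y = 1 & (g * h)%g = 1%g].
Proof.
move=> nd buv.
(* Pairing with [u] only serves to produce a nonzero homogeneous [x]; its partner [y] is then sought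
   by pairing with [x] itself. *)
have [|g [x [xg bux]]] := B12_odd_form_neq0 (w := u) (y0 := v).
  by rewrite buv oner_eq0.
have x0 : x != 0 by apply: contraNneq bux => ->; rewrite linear0r.
have [y0 bxy0] := nondegenerate_pair nd x0.
have [h [y [yh bxy]]] := B12_odd_form_neq0 bxy0.
have bxy' : b x ((b x y)^-1 *: y) = 1 by rewrite linearZr /= mulVf.
have y'h : (B12_vector ((b x y)^-1 *: y) : B12 b) \in Gam h.
  by rewrite B12_vectorZ memvZ.
exists g, h, x, ((b x y)^-1 *: y); split=> //.
have [Ggr _ _] := Gr; have [_ _ mulG] := Ggr.
(* The unit is the product of the two vectors, so it has degree [g * h] as well as the neutral
   degree. *)
apply: (homogeneous_degree_inj Ggr _ _ B12_one_degree) => [|].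
  by rewrite xpair_eqE oner_eq0.
suff -> : B12_scalar V 1 = sa_mul (B12 b) (B12_vector x)
    (B12_vector ((b x y)^-1 *: y)) by apply: mulG.
by congr pair; rewrite /= ?bxy' ?scale0r ?mul0r add0r.
Qed.

Lemma B12_grading_classification (u v : V) :
  nondegenerate_form b -> b u v = 1 -> ~ trivial_grading Gam ->
  equivalent_gradings Gam (B12_Zgrading b u v) \/
  equivalent_gradings Gam (sa_main (B12 b)).
Proof.
move=> nd buv nontriv; have [[dirG _ _] _ _] := Gr.
have [g [h [x [y [xg yh bxy gh]]]]] := B12_hyperbolic_degrees nd buv.
have e1 := B12_one_degree; have full := B12_hyperbolic_full dimV b_alt bxy.
have [eq_gh|neq_gh] := eqVneq g h.
  right; subst h.
  (* Otherwise the unit, [x] and [y] would all have neutral degree, and these span the algebra. *)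
  have g1 : g != 1%g.
    apply/eqP=> g1; subst g; apply: nontriv; apply/eqP.
    by rewrite eqEsubv subvf /= -full !subv_add -!memvE e1 xg yh.
  pose W k : {vspace B12 b} :=
    if k == 1%g then sa_main (B12 b) 0 else
    if k == g then sa_main (B12 b) 1 else 0%VS.
  have odd_eq : sa_main (B12 b) 1 = (<[B12_vector x]> + <[B12_vector y]>)%VS.
    apply/eqP; rewrite eqEsubv subv_add -!memvE !mem_B12_main !eqxx andbT.
    apply/subvP=> z; rewrite mem_B12_main /= => /eqP z1.
    apply/memv_addP; exists (B12_vector (b z.2 y *: x)).
      exact: B12_vector_line.
    exists (B12_vector (b x z.2 *: y)); first exact: B12_vector_line.
    rewrite [LHS]surjective_pairing z1; congr pair; rewrite /= ?addr0 //.
    exact: hyperbolic_expand.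
  have GW : forall k, Gam k = W k.
    apply: (direct_family_eq (W := W) (s := [:: 1%g; g]) dirG) => [|k|].
    - by rewrite /= inE eq_sym g1.
    - rewrite /W; case: eqP => [->|_]; first by rewrite -memvE.
      case: eqP => [->|_]; last exact: sub0v.
      by rewrite odd_eq subv_add -!memvE xg yh.
    - by rewrite !big_cons big_nil addv0 /W eqxx (negPf g1) eqxx B12_main_full.
  (* The nonzero components are already the even and odd parts, so the identity is an
     equivalence. *)
  exists \1%VF; split; first split=> [|z t|i].
  - by exists id => z; rewrite id_lfunE.
  - by rewrite !id_lfunE.
  - by rewrite lim1g.
  - move=> k; rewrite GW /W lim1g.
    by case: ifP => _; [exists 0|case: ifP => _; [exists 1|rewrite eqxx]].
left.
(* As [g * h] is neutral, one neutral factor would make both neutral and hence equal. *)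
have g1 : g != 1%g.
  by apply: contraNneq neq_gh => g1; move: gh; rewrite g1 mul1g => ->.
have h1 : h != 1%g.
  by apply: contraNneq neq_gh => h1; move: gh; rewrite h1 mulg1 => ->.
pose W k : {vspace B12 b} :=
  if k == 1%g then <[B12_scalar V 1]>%VS else
  if k == g then <[B12_vector x]>%VS else
  if k == h then <[B12_vector y]>%VS else 0%VS.
have GW : forall k, Gam k = W k.
  apply: (direct_family_eq (W := W) (s := [:: 1%g; g; h]) dirG) => [|k|].
  - by rewrite /= !inE negb_or eq_sym g1 eq_sym h1 neq_gh.
  - rewrite /W; case: eqP => [->|_]; first by rewrite -memvE.
    case: eqP => [->|_]; first by rewrite -memvE.
    by case: eqP => [->|_]; rewrite ?sub0v // -memvE.
  - rewrite !big_cons big_nil addv0 /W eqxx (negPf g1) eqxx (negPf h1).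
    by rewrite [h == g]eq_sym (negPf neq_gh) eqxx.
(* The lines of the unit, [x] and [y] go to those of the unit, [u] and [v], in degrees [0], [1] and
   [-1]. *)
exists (linfun (hyperbolic_map x y u v)).
split; first exact: hyperbolic_map_iso.
move=> k; rewrite GW /W.
case: ifP => _; [|case: ifP => _; [|case: ifP => _; [|by rewrite eqxx]]] => _;
  rewrite limg_line lfunE.
- exists (0 : int); congr <[_]>%VS; congr pair.
  by rewrite /= linear0l linear0r !scale0r addr0.
- exists (1 : int); congr <[_]>%VS; congr pair.
  by rewrite /= bxy b_alt scale1r scale0r addr0.
- exists (-1 : int); congr <[_]>%VS; congr pair.
  by rewrite /= bxy b_alt scale1r scale0r add0r.
Qed.

End Grading.
End Classification.

(** Existence of a hyperbolic basis keeps the second clause from being vacuous, and inequivalence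
    makes the list irredundant. *)
Theorem theorem11 (F : fieldType) (charF : 3%N \in [pchar F])
    (V : vectType F) (dimV : \dim {:V} = 2%N)
    (b : {biscalar V}) (b_alt : alternating_form b)
    (b_nondeg : nondegenerate_form b) :
  (exists u v : V, basis_of {:V} [:: u; v] /\ b u v = 1) /\
  (forall u v : V, basis_of {:V} [:: u; v] -> b u v = 1 ->
    [/\ super_grading (B12_Zgrading b u v) /\
          ~ trivial_grading (B12_Zgrading b u v),
        super_grading (sa_main (B12 b)) /\
          ~ trivial_grading (sa_main (B12 b)),
        ~ equivalent_gradings (B12_Zgrading b u v) (sa_main (B12 b))
      & forall (G : groupType) (Gam : G -> {vspace B12 b}),
          super_grading Gam -> ~ trivial_grading Gam ->
          equivalent_gradings Gam (B12_Zgrading b u v) \/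
          equivalent_gradings Gam (sa_main (B12 b))]).
Proof.
split=> [|u v _ buv].
  have [x x0] : exists x : V, x != 0.
    have [z|/subvPn[x _]] := boolP (fullv <= (0 : {vspace V}))%VS.
      by move: dimV; rewrite subv0 in z; rewrite (eqP z) dimv0.
    by rewrite memv0; exists x.
  have [y bxy] := nondegenerate_pair b_nondeg x0.
  have bxy1 : b x ((b x y)^-1 *: y) = 1 by rewrite linearZr /= mulVf.
  exists x, ((b x y)^-1 *: y); split=> //.
  exact: hyperbolic_basis bxy1.
split.
- by split; [apply: B12_Zgrading_super|apply: B12_Zgrading_nontrivial].
- by split; [apply: B12_main_super|apply: B12_main_nontrivial].
- exact: B12_Zgrading_not_main.
- by move=> G Gam Gr; apply: B12_grading_classification.
Qed.
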